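(* Let $t$ be a term. For every extended context $\Gamma;s$, if $\Gamma;s\vdash t\ \mathrm{wf}$ then either $t$ is a normal form or there exists a term $t'$ with $t\mapsto t'$.
   Context: Terms: $t ::= x \mid \top \mid (\lambda x\leq t.u) \mid (u\,v)$, with $x$ from a countably infinite set of variables and $\top$ a constant; $x$ is bound in $u$ in $\lambda x\leq t.u$; terms identified up to renaming of bound variables; $\mathrm{fv}$ = free variables, $u[x:=v]$ = capture-avoiding substitution. $\mapsto$ is the least relation with $(\lambda x\leq t.u)\,v\mapsto u[x:=v]$ closed under all term contexts (if $t\mapsto t'$ then $\lambda x\leq t.u\mapsto\lambda x\leq t'.u$, $\lambda x\leq u.t\mapsto\lambda x\leq u.t'$, $t\,u\mapsto t'\,u$, $u\,t\mapsto u\,t'$). Normal forms are given by $t_n ::= \top \mid \lambda x\leq t_n.u_n \mid x\,t_{n,1}\cdots t_{n,k}$ ($k\ge 0$, all components normal forms). Extended context $\Gamma;s$: a finite sequence $\Gamma$ of annotations $x\leq t$ and a finite list (stack) $s$ of terms; $\varepsilon;[]$ empty, $\Gamma,x\leq t;s$ appends an annotation, $\Gamma;\alpha::s$ pushes $\alpha$. $\mathrm{dom}(\Gamma)$ = annotated variables; $x\leq t\in\Gamma$ means the annotation occurs in $\Gamma$; ''$x$ has subtype $t$ in $\Gamma$'' means $x\leq t$ is the last annotation for $x$ in $\Gamma$. Prevalidity: least predicate with $\varepsilon;[]$ prevalid; $\Gamma,x\leq t;[]$ prevalid if $\Gamma;[]$ prevalid, $x\notin\mathrm{dom}(\Gamma)$,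 $\mathrm{fv}(t)\subseteq\mathrm{dom}(\Gamma)$; $\Gamma;\alpha::s$ prevalid if $\Gamma;s$ prevalid and $\mathrm{fv}(\alpha)\subseteq\mathrm{dom}(\Gamma)$. Equivalence reduction $\to_{\equiv}$: least relation with $x\to_{\equiv}x$; $\top\to_{\equiv}\top$; $\top\,u\to_{\equiv}\top$; if $u\to_{\equiv}u'$, $v\to_{\equiv}v'$ then $u\,v\to_{\equiv}u'\,v'$ and $(\lambda x\leq t.u)\,v\to_{\equiv}u'[x:=v']$; if $t\to_{\equiv}t'$, $u\to_{\equiv}u'$ then $\lambda x\leq t.u\to_{\equiv}\lambda x\leq t'.u'$. Subtyping reduction $\Gamma;s\vdash u\to_{\leq}v$: least relation with (Prom) $\Gamma;s$ prevalid and $x\leq t\in\Gamma$ give $\Gamma;s\vdash x\to_{\leq}t$; (Top) $\Gamma;s$ prevalid gives $\Gamma;s\vdash u\to_{\leq}\top$; (Eq) $\Gamma;s$ prevalid and $u\to_{\equiv}v$ give $\Gamma;s\vdash u\to_{\leq}v$; (App) $\Gamma;v::s\vdash u\to_{\leq}u'$ gives $\Gamma;s\vdash u\,v\to_{\leq}u'\,v$; (FunOp) $\Gamma,x\leq\alpha;s\vdash u\to_{\leq}u'$ gives $\Gamma;\alpha::s\vdash\lambda x\leq t.u\to_{\leq}\lambda x\leq t.u'$; (Fun) $\Gamma,x\leq t;[]\vdash u\to_{\leq}u'$ gives $\Gamma;[]\vdash\lambda x\leq t.u\to_{\leq}\lambda x\leq t.u'$. Subtyping: $\Gamma;s\vdash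 v\leq t$ is the least relation with: if $\Gamma;s$ prevalid then $\Gamma;s\vdash t\leq t$; if $\Gamma;s\vdash v\to_{\leq}v'$ and $\Gamma;s\vdash v'\leq t$ then $\Gamma;s\vdash v\leq t$; if $\Gamma;s\vdash v\leq t'$ and $t\to_{\equiv}t'$ then $\Gamma;s\vdash v\leq t$. Well-formedness $\Gamma;s\vdash t\ \mathrm{wf}$, well-subtyping $\leq_{\mathrm{wf}}$ and transitive well-subtyping $\leq^*_{\mathrm{wf}}$ are the least relations (defined simultaneously) with: (W-Var) if $\Gamma;s$ prevalid, $x$ has subtype $t$ in $\Gamma$ and $\Gamma;s\vdash t\ \mathrm{wf}$ then $\Gamma;s\vdash x\ \mathrm{wf}$; (W-Top) if $\Gamma;s$ prevalid then $\Gamma;s\vdash\top\ \mathrm{wf}$; (W-Fun) if $\Gamma,x\leq t;[]\vdash u\ \mathrm{wf}$ and $\Gamma;[]\vdash t\ \mathrm{wf}$ then $\Gamma;[]\vdash\lambda x\leq t.u\ \mathrm{wf}$; (W-FunOp) if $\Gamma,x\leq\delta;s\vdash u\ \mathrm{wf}$ and $\Gamma;[]\vdash t\ \mathrm{wf}$ then $\Gamma;\delta::s\vdash\lambda x\leq t.u\ \mathrm{wf}$; (W-App) if $\Gamma;v::s\vdash u\leq^*_{\mathrm{wf}}\lambda x\leq t.\top$ and $\Gamma;[]\vdash v\leq^*_{\mathrm{wf}}t$ then $\Gamma;s\vdash u\,v\ \mathrm{wf}$; (Wf-Rule) if $\Gamma;s\vdash u\ \mathrm{wf}$, $\Gamma;s\vdash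 t\ \mathrm{wf}$ and $\Gamma;s\vdash u\leq t$ then $\Gamma;s\vdash u\leq_{\mathrm{wf}}t$; (Wf-Sub) $\Gamma;s\vdash v\leq_{\mathrm{wf}}t$ gives $\Gamma;s\vdash v\leq^*_{\mathrm{wf}}t$; (Wf-Trans) if $\Gamma;s\vdash v\leq^*_{\mathrm{wf}}u$, $\Gamma;s\vdash u\leq^*_{\mathrm{wf}}t$ and $\Gamma;s\vdash u\ \mathrm{wf}$ then $\Gamma;s\vdash v\leq^*_{\mathrm{wf}}t$. *)

(* Defs.v *)
From Stdlib Require Import List PeanoNat.
Import ListNotations.

(** Terms modulo renaming of bound variables: [tm V] is the set of
    alpha-equivalence classes of terms with free variables in [V], the body of
    an abstraction having one extra free variable [None] (the bound one). *)
Inductive tm (V : Type) : Type :=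
| Var (x : V)
| Top
| Lam (t : tm V) (b : tm (option V))
| App (u v : tm V).

Arguments Var {V} x.
Arguments Top {V}.
Arguments Lam {V} t b.
Arguments App {V} u v.

Fixpoint rename {V W : Type} (f : V -> W) (t : tm V) : tm W :=
  match t with
  | Var x => Var (f x)
  | Top => Top
  | Lam a b => Lam (rename f a) (rename (option_map f) b)
  | App u v => App (rename f u) (rename f v)
  end.

Definition up {V W : Type} (f : V -> tm W) (o : option V) : tm (option W) :=
  match o with
  | None => Var None
  | Some x => rename Some (f x)
  end.

Fixpoint bind {V W : Type} (f : V -> tm W) (t : tm V) : tm W :=
  match t with
  | Var x => f x
  | Top => Top
  | Lam a b => Lam (bind f a) (bind (up f) b)
  | App u v => App (bind f u) (bind f v)
  end.

(** [fv t x]: the variable [x] is free in [t]. *)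
Fixpoint fv {V : Type} (t : tm V) : V -> Prop :=
  match t with
  | Var y => fun x => x = y
  | Top => fun _ => False
  | Lam a b => fun x => fv a x \/ fv b (Some x)
  | App u v => fun x => fv u x \/ fv v x
  end.

Definition var := nat.
Definition term := tm var.

(** The named abstraction [λx≤t.u]. Every [Lam t b : term] is of this form, for
    any [x] not free in [b], and [lam x t u = lam y t u'] holds exactly
    when the two sides are alpha-equivalent; so the rules below, which
    quantify over the bound name, apply to any choice of representative. *)
Definition lam (x : var) (t u : term) : term :=
  Lam t (rename (fun y => if Nat.eqb y x then None else Some y) u).

(** [subst u x v] is [u[x:=v]]. *)
Definition subst (u : term) (x : var) (v : term) : term :=
  bind (fun y => if Nat.eqb y x then v else Var y) u.

(** The reduction [↦]. *)
Inductive step : term -> term -> Prop :=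
| step_beta x t u v : step (App (lam x t u) v) (subst u x v)
| step_lam_body x t u u' : step u u' -> step (lam x t u) (lam x t u')
| step_lam_ann x t t' u : step t t' -> step (lam x t u) (lam x t' u)
| step_app_l t t' u : step t t' -> step (App t u) (App t' u)
| step_app_r u t t' : step t t' -> step (App u t) (App u t').

Inductive normal_form : term -> Prop :=
| nf_top : normal_form Top
| nf_lam x t u : normal_form t -> normal_form u -> normal_form (lam x t u)
| nf_spine x ts :
    (forall t, In t ts -> normal_form t) ->
    normal_form (fold_left App ts (Var x)).

(** Extended contexts [Γ;s] are given by two arguments. The head of a context is
    its last (most recent) annotation: [Γ,x≤t] is [(x, t) :: Γ]. *)
Definition ctx := list (var * term).
Definition stack := list term.

Definition dom (G : ctx) : list var := map fst G.

Definition has_subtype (G : ctx) (x : var) (t : term) : Prop :=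
  exists G1 G2 : ctx, G = G2 ++ (x, t) :: G1 /\ ~ In x (dom G2).

Definition scoped (G : ctx) (t : term) : Prop :=
  forall x, fv t x -> In x (dom G).

Inductive prevalid : ctx -> stack -> Prop :=
| pv_empty : prevalid [] []
| pv_ann G x t :
    prevalid G [] -> ~ In x (dom G) -> scoped G t -> prevalid ((x, t) :: G) []
| pv_push G s a :
    prevalid G s -> scoped G a -> prevalid G (a :: s).

(** Equivalence reduction. *)
Inductive eq_red : term -> term -> Prop :=
| er_var x : eq_red (Var x) (Var x)
| er_top : eq_red Top Top
| er_top_app u : eq_red (App Top u) Top
| er_app u u' v v' :
    eq_red u u' -> eq_red v v' -> eq_red (App u v) (App u' v')
| er_beta x t u u' v v' :
    eq_red u u' -> eq_red v v' ->
    eq_red (App (lam x t u) v) (subst u' x v')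
| er_lam x t t' u u' :
    eq_red t t' -> eq_red u u' -> eq_red (lam x t u) (lam x t' u').

(** Subtyping reduction. *)
Inductive sub_red : ctx -> stack -> term -> term -> Prop :=
| sr_prom G s x t :
    prevalid G s -> In (x, t) G -> sub_red G s (Var x) t
| sr_top G s u :
    prevalid G s -> sub_red G s u Top
| sr_eq G s u v :
    prevalid G s -> eq_red u v -> sub_red G s u v
| sr_app G s u u' v :
    sub_red G (v :: s) u u' -> sub_red G s (App u v) (App u' v)
| sr_fun_op G s x a t u u' :
    sub_red ((x, a) :: G) s u u' ->
    sub_red G (a :: s) (lam x t u) (lam x t u')
| sr_fun G x t u u' :
    sub_red ((x, t) :: G) [] u u' ->
    sub_red G [] (lam x t u) (lam x t u').

(** Subtyping [Γ;s ⊢ v ≤ t]. *)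
Inductive sub : ctx -> stack -> term -> term -> Prop :=
| sub_refl G s t :
    prevalid G s -> sub G s t t
| sub_left G s v v' t :
    sub_red G s v v' -> sub G s v' t -> sub G s v t
| sub_right G s v t t' :
    sub G s v t' -> eq_red t t' -> sub G s v t.

(** Well-formedness, well-subtyping and transitive well-subtyping. *)
Inductive wf : ctx -> stack -> term -> Prop :=
| w_var G s x t :
    prevalid G s -> has_subtype G x t -> wf G s t -> wf G s (Var x)
| w_top G s :
    prevalid G s -> wf G s Top
| w_fun G x t u :
    wf ((x, t) :: G) [] u -> wf G [] t -> wf G [] (lam x t u)
| w_fun_op G s x d t u :
    wf ((x, d) :: G) s u -> wf G [] t -> wf G (d :: s) (lam x t u)
| w_app G s u v x t :
    sub_wf_star G (v :: s) u (lam x t Top) ->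
    sub_wf_star G [] v t ->
    wf G s (App u v)
with sub_wf : ctx -> stack -> term -> term -> Prop :=
| wf_rule G s u t :
    wf G s u -> wf G s t -> sub G s u t -> sub_wf G s u t
with sub_wf_star : ctx -> stack -> term -> term -> Prop :=
| wf_sub G s v t :
    sub_wf G s v t -> sub_wf_star G s v t
| wf_trans G s v u t :
    sub_wf_star G s v u -> sub_wf_star G s u t -> wf G s u ->
    sub_wf_star G s v t.

(* Main.v *)
(** A term can fail to progress only because of an application [App Top v], so
    it suffices that [Top] is never a transitive well-subtype of an abstraction.
    Call a term collapsing if it reduces to [Top] by equivalence reductions. An
    abstraction does not collapse, and collapsing is inherited by supertypes: for
    equivalence reduction this is confluence, and a promotion at the head of a
    collapsing term can only replace a variable by the operand which the
    corresponding beta-reduction substitutes for it, since a term headed by a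
    genuinely free variable does not collapse. *)
From Stdlib Require Import List PeanoNat Relations.
Require Import Defs.
Import ListNotations.

(** * Renaming, substitution and free variables *)

Lemma rename_ext {V W : Type} (f g : V -> W) (t : tm V) :
  (forall x, f x = g x) -> rename f t = rename g t.
Proof.
  revert W f g; induction t; simpl; intros W f g H; f_equal; auto.
  apply IHt2; intros [y|]; simpl; congruence.
Qed.

Lemma bind_ext {V W : Type} (f g : V -> tm W) (t : tm V) :
  (forall x, fv t x -> f x = g x) -> bind f t = bind g t.
Proof.
  revert W f g; induction t; simpl; intros W f g H; f_equal; auto.
  apply IHt2; intros [y|] Hy; simpl; f_equal; auto.
Qed.

Lemma rename_rename {V W X : Type} (f : V -> W) (g : W -> X) (t : tm V) :
  rename g (rename f t) = rename (fun x => g (f x)) t.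
Proof.
  revert W X f g; induction t; simpl; intros W X f g; f_equal; auto.
  rewrite IHt2; apply rename_ext; now intros [y|].
Qed.

Lemma bind_rename {V W X : Type} (f : V -> W) (g : W -> tm X) (t : tm V) :
  bind g (rename f t) = bind (fun x => g (f x)) t.
Proof.
  revert W X f g; induction t; simpl; intros W X f g; f_equal; auto.
  rewrite IHt2; apply bind_ext; now intros [y|].
Qed.

Lemma rename_bind {V W X : Type} (f : V -> tm W) (g : W -> X) (t : tm V) :
  rename g (bind f t) = bind (fun x => rename g (f x)) t.
Proof.
  revert W X f g; induction t; simpl; intros W X f g; f_equal; auto.
  rewrite IHt2; apply bind_ext; intros [y|] _; simpl; auto.
  now rewrite !rename_rename.
Qed.

Lemma bind_bind {V W X : Type} (f : V -> tm W) (g : W -> tm X) (t : tm V) :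
  bind g (bind f t) = bind (fun x => bind g (f x)) t.
Proof.
  revert W X f g; induction t; simpl; intros W X f g; f_equal; auto.
  rewrite IHt2; apply bind_ext; intros [y|] _; simpl; auto.
  now rewrite bind_rename, rename_bind.
Qed.

Lemma bind_Var {V : Type} (t : tm V) : bind Var t = t.
Proof.
  induction t; simpl; f_equal; auto.
  rewrite <- IHt2 at 2; apply bind_ext; now intros [y|].
Qed.

Lemma fv_rename {V W : Type} (f : V -> W) (t : tm V) x :
  fv t x -> fv (rename f t) (f x).
Proof.
  revert W f x; induction t; simpl; intros W f y H.
  - now subst.
  - easy.
  - destruct H; [left; auto | right].
    exact (IHt2 _ (option_map f) (Some y) H).
  - destruct H; auto.
Qed.

Lemma fv_rename_inv {V W : Type} (f : V -> W) (t : tm V) y :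
  fv (rename f t) y -> exists x, fv t x /\ y = f x.
Proof.
  revert W f y; induction t; simpl; intros W f y H.
  - eauto.
  - easy.
  - destruct H as [H|H].
    + destruct (IHt1 _ _ _ H) as (x & ? & ?); eauto.
    + destruct (IHt2 _ _ _ H) as ([x|] & ? & E); simpl in E; [|easy].
      injection E; eauto.
  - destruct H as [H|H];
      [destruct (IHt1 _ _ _ H) as (x & ? & ?) | destruct (IHt2 _ _ _ H) as (x & ? & ?)];
      eauto.
Qed.

Lemma fv_bind_inv {V W : Type} (f : V -> tm W) (t : tm V) y :
  fv (bind f t) y -> exists x, fv t x /\ fv (f x) y.
Proof.
  revert W f y; induction t; simpl; intros W f y H.
  - eauto.
  - easy.
  - destruct H as [H|H].
    + destruct (IHt1 _ _ _ H) as (x & ? & ?); eauto.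
    + destruct (IHt2 _ _ _ H) as ([x|] & ? & E); simpl in E; [|easy].
      destruct (fv_rename_inv _ _ _ E) as (z & ? & Ez).
      injection Ez; intros ->; eauto.
  - destruct H as [H|H];
      [destruct (IHt1 _ _ _ H) as (x & ? & ?) | destruct (IHt2 _ _ _ H) as (x & ? & ?)];
      eauto.
Qed.

(** * Parallel reduction and complete development *)

Definition inst {V : Type} (v : tm V) (o : option V) : tm V :=
  match o with None => v | Some x => Var x end.

(** Equivalence reduction over an arbitrary set of free variables, without
    bound names. *)
Inductive par (V : Type) : tm V -> tm V -> Prop :=
| par_var x : par V (Var x) (Var x)
| par_top : par V Top Top
| par_top_app u : par V (App Top u) Top
| par_app u u' v v' : par V u u' -> par V v v' -> par V (App u v) (App u' v')
| par_beta a b b' v v' :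
    par (option V) b b' -> par V v v' ->
    par V (App (Lam a b) v) (bind (inst v') b')
| par_lam a a' b b' :
    par V a a' -> par (option V) b b' -> par V (Lam a b) (Lam a' b').

Arguments par {V} _ _.
Local Hint Constructors par : par.

Lemma par_refl {V : Type} (t : tm V) : par t t.
Proof. induction t; auto with par. Qed.
Local Hint Resolve par_refl : par.

Lemma par_rename {V W : Type} (f : V -> W) (t t' : tm V) :
  par t t' -> par (rename f t) (rename f t').
Proof.
  intros H; revert W f; induction H; simpl; intros W f; auto with par.
  rewrite rename_bind.
  rewrite (bind_ext _ (fun o => inst (rename f v') (option_map f o)))
    by now intros [y|].
  rewrite <- bind_rename; auto with par.
Qed.

Lemma par_bind {V W : Type} (f g : V -> tm W) (t t' : tm V) :
  par t t' -> (forall x, par (f x) (g x)) -> par (bind f t) (bind g t').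
Proof.
  assert (up_par : forall (V W : Type) (f g : V -> tm W),
             (forall x, par (f x) (g x)) -> forall o, par (up f o) (up g o)).
  { intros X Y h k H [x|]; simpl; auto using par_rename with par. }
  intros H; revert W f g; induction H; simpl; intros W f g Hfg; auto with par.
  rewrite bind_bind.
  (* Contracting and then applying [g] amounts to applying [up g] to the body and then instantiating
     with [bind g v']. *)
  rewrite (bind_ext _ (fun o => bind (inst (bind g v')) (up g o))).
  - rewrite <- bind_bind; auto with par.
  - intros [y|] _; simpl; auto.
    rewrite bind_rename; symmetry; apply bind_Var.
Qed.

Lemma par_fv {V : Type} (t t' : tm V) x : par t t' -> fv t' x -> fv t x.
Proof.
  intros H; revert x; induction H; simpl; intros y Hy; try tauto.
  - destruct Hy; auto.
  - destruct (fv_bind_inv _ _ _ Hy) as ([z|] & Hz & E); simpl in E; auto.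
    subst; auto.
  - destruct Hy; auto.
Qed.

(** Takahashi's complete development: all redexes present in [t], including those of the form
    [App Top v], are contracted at once. *)
Fixpoint dev {V : Type} (t : tm V) : tm V :=
  match t with
  | Var x => Var x
  | Top => Top
  | Lam a b => Lam (dev a) (dev b)
  | App u v =>
      match u with
      | Lam a b => bind (inst (dev v)) (dev b)
      | Top => Top
      | _ => App (dev u) (dev v)
      end
  end.

(** Triangle property, the source of confluence: [dev t] is a common reduct of any two one-step
    reducts of [t]. *)
Lemma par_dev {V : Type} (t t' : tm V) : par t t' -> par t' (dev t).
Proof.
  induction 1; simpl; auto with par.
  - destruct u; simpl in *; auto with par.
    + inversion H; subst; auto with par.
    + inversion H; subst; inversion IHpar1; subst; auto with par.
  - apply par_bind; auto; intros [x|]; simpl; auto with par.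
Qed.

(** * Collapsing terms *)

Definition collapses {V : Type} (t : tm V) : Prop :=
  clos_refl_trans_1n _ par t Top.

Lemma collapses_expand {V : Type} (t t' : tm V) :
  par t t' -> collapses t' -> collapses t.
Proof. intros; eapply Relation_Operators.rt1n_trans; eauto. Qed.

(** If [t1] is the first reduct on the way to [Top], both [t1] and [t'] reduce to [dev t]. By
    induction [dev t] collapses, hence so does [t']. *)
Lemma collapses_par {V : Type} (t t' : tm V) :
  collapses t -> par t t' -> collapses t'.
Proof.
  unfold collapses; intros H; revert t'.
  remember Top as p eqn:Ep; induction H as [|t t1 p Ht1 _ IH];
    intros t' Ht'; subst.
  - inversion Ht'; constructor.
  - eapply collapses_expand; [apply par_dev, Ht'|].
    apply IH; auto using par_dev.
Qed.

Lemma Lam_not_collapses {V : Type} (a : tm V) b : ~ collapses (Lam a b).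
Proof.
  unfold collapses; intros H.
  remember (Lam a b) as t eqn:Et; remember Top as p eqn:Ep.
  revert a b Et; induction H as [|t t1 p Ht1 _ IH]; intros a b Et; subst.
  - easy.
  - inversion Ht1; subst; eapply IH; eauto.
Qed.

Fixpoint var_headed {V : Type} (t : tm V) : Prop :=
  match t with
  | Var _ => True
  | App u _ => var_headed u
  | _ => False
  end.

(** No redex involves the head variable: reduction acts only inside the operands. *)
Lemma var_headed_par {V : Type} (t t' : tm V) :
  par t t' -> var_headed t -> var_headed t'.
Proof. induction 1; simpl; tauto. Qed.

Lemma var_headed_not_collapses {V : Type} (t : tm V) :
  var_headed t -> ~ collapses t.
Proof.
  unfold collapses; intros Ht H.
  remember Top as p eqn:Ep.
  induction H; subst; [easy|]; eauto using var_headed_par.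
Qed.

Definition apps {V : Type} (t : tm V) (ts : list (tm V)) : tm V :=
  fold_left App ts t.

Lemma apps_par {V : Type} (t t' : tm V) ts :
  par t t' -> par (apps t ts) (apps t' ts).
Proof.
  revert t t'; induction ts; simpl; intros; auto with par.
Qed.

Lemma apps_var_headed {V : Type} (t : tm V) ts :
  var_headed t -> var_headed (apps t ts).
Proof. revert t; induction ts; simpl; intros; auto. Qed.

Lemma apps_Top_collapses {V : Type} (ts : list (tm V)) :
  collapses (apps Top ts).
Proof.
  induction ts; simpl; [constructor|].
  exact (collapses_expand _ _ (apps_par _ _ _ (par_top_app _ _)) IHts).
Qed.

(** * From named to nameless rules; scoping *)

Lemma subst_close (x : var) (u v : term) :
  subst u x v =
  bind (inst v) (rename (fun y => if Nat.eqb y x then None else Some y) u).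
Proof.
  rewrite bind_rename; apply bind_ext; intros y _.
  now destruct (Nat.eqb y x).
Qed.

Lemma eq_red_par (t t' : term) : eq_red t t' -> par t t'.
Proof.
  induction 1; auto with par.
  - rewrite subst_close; unfold lam; auto using par_rename with par.
  - unfold lam; auto using par_rename with par.
Qed.

Lemma scoped_lam_body G x a t u :
  scoped G (lam x t u) -> scoped ((x, a) :: G) u.
Proof.
  intros H y Hy; simpl; destruct (Nat.eq_dec y x) as [->|E]; auto.
  right; apply H; right.
  apply (fv_rename (fun y => if Nat.eqb y x then None else Some y)) in Hy.
  now apply Nat.eqb_neq in E; rewrite E in Hy.
Qed.

Lemma scoped_lam G x a t u :
  scoped G t -> scoped ((x, a) :: G) u -> scoped G (lam x t u).
Proof.
  intros Ht Hu y [Hy|Hy]; auto.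
  destruct (fv_rename_inv _ _ _ Hy) as (z & Hz & E).
  destruct (Nat.eqb_spec z x) as [->|Hne]; [easy|].
  injection E as ->; destruct (Hu _ Hz); simpl in *; [congruence | auto].
Qed.

Lemma prevalid_ctx G s : prevalid G s -> prevalid G [].
Proof. induction 1; auto using prevalid. Qed.

Lemma prevalid_stack G s : prevalid G s -> Forall (scoped G) s.
Proof. induction 1; auto. Qed.

Lemma prevalid_scoped G s x t : prevalid G s -> In (x, t) G -> scoped G t.
Proof.
  induction 1; simpl; intros Hin y Hy.
  - easy.
  - destruct Hin as [E|Hin].
    + injection E as -> ->; simpl; auto.
    + right; now apply IHprevalid.
  - now apply IHprevalid.
Qed.

Lemma sub_red_prevalid_ctx G s u v : sub_red G s u v -> prevalid G [].
Proof.
  induction 1; eauto using prevalid_ctx; now inversion IHsub_red.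
Qed.

Lemma sub_red_scoped G s u v : sub_red G s u v -> scoped G u -> scoped G v.
Proof.
  induction 1; intros Hu.
  - eauto using prevalid_scoped.
  - easy.
  - intros y Hy; eapply Hu, par_fv; eauto using eq_red_par.
  - intros y [Hy|Hy]; [apply IHsub_red; auto; intros z Hz|]; apply Hu; simpl; auto.
  - apply scoped_lam with a; eauto using scoped_lam_body.
    intros y Hy; apply Hu; simpl; auto.
  - apply scoped_lam with t; eauto using scoped_lam_body.
    intros y Hy; apply Hu; simpl; auto.
Qed.

(** * Collapsing along subtyping *)

(** [f] realises the annotations of [G] introduced by the rule (FunOp), which
    are operands, and keeps the other annotated variables free. *)
Definition realises (f : var -> term) (G : ctx) : Prop :=
  forall x t, In (x, t) G -> f x = bind f t \/ exists y, f x = Var y.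

Definition update (f : var -> term) (x : var) (v : term) (y : var) : term :=
  if Nat.eqb y x then v else f y.

Lemma bind_update_scoped G f x v t :
  ~ In x (dom G) -> scoped G t -> bind (update f x v) t = bind f t.
Proof.
  intros Hx Ht; apply bind_ext; intros y Hy; unfold update.
  destruct (Nat.eqb_spec y x); subst; firstorder.
Qed.

(** By prevalidity [x] is free neither in [a] nor in the annotations of [G], so the update does not
    change their images. *)
Lemma realises_update G f x a :
  prevalid ((x, a) :: G) [] -> realises f G ->
  realises (update f x (bind f a)) ((x, a) :: G).
Proof.
  intros Hp Hf; inversion Hp; subst; intros y t [E|Hin].
  - injection E as <- <-; left; erewrite bind_update_scoped; eauto.
    unfold update; now rewrite Nat.eqb_refl.
  - erewrite (bind_update_scoped G f x _ t); eauto using prevalid_scoped.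
    unfold update; destruct (Nat.eqb_spec y x); auto.
    subst; exfalso; apply (in_map fst) in Hin; auto.
Qed.

Lemma bind_lam_beta (f : var -> term) x t u v :
  par (App (bind f (lam x t u)) v) (bind (update f x v) u).
Proof.
  replace (bind (update f x v) u)
    with (bind (inst v)
            (bind (up f) (rename (fun y => if Nat.eqb y x then None else Some y) u))).
  - simpl; auto with par.
  - rewrite bind_bind, bind_rename; apply bind_ext; intros y _; unfold update.
    destruct (Nat.eqb y x); simpl; auto.
    rewrite bind_rename; apply bind_Var.
Qed.

(** The induction needs a generalised form: [args] is the part of the stack whose operands are
    really applied to [u], [rest] is the part that the term does not see, and [f] performs the
    beta-reductions recorded by (FunOp). *)
Lemma sub_red_collapses G s u u' :
  sub_red G s u u' ->
  forall f args rest,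
    s = args ++ rest -> Forall (scoped G) s -> scoped G u -> realises f G ->
    collapses (apps (bind f u) (map (bind f) args)) ->
    collapses (apps (bind f u') (map (bind f) args)).
Proof.
  induction 1 as [G s x t Hp Hx | | G s u v Hp Huv | G s u u' v H IH
                 | G s x a t u u' H IH | G x t u u' H IH];
    intros f args rest Es Hs Hu Hf Hc.
  (* Either [f x] is already the image of the annotation and nothing changes, or the head is a free
     variable, which rules out collapsing. *)
  - simpl in Hc; destruct (Hf _ _ Hx) as [E|[y E]]; rewrite E in Hc; auto.
    exfalso; eapply var_headed_not_collapses; [apply apps_var_headed|]; [|exact Hc].
    exact I.
  - apply apps_Top_collapses.
  - eapply collapses_par; [exact Hc|].
    apply apps_par, par_bind; auto using eq_red_par with par.
  - apply (IH f (v :: args) rest); auto.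
    + simpl; congruence.
    + constructor; auto; intros y Hy; apply Hu; simpl; auto.
    + intros y Hy; apply Hu; simpl; auto.
  - destruct args as [|a' args]; [now apply Lam_not_collapses in Hc|].
    injection Es as <- Es.
    pose proof (sub_red_prevalid_ctx _ _ _ _ H) as Hp.
    inversion Hp as [|? ? ? _ Hx Ha|]; subst; inversion Hs as [|? ? _ Hs']; subst.
    (* The remaining operands are scoped in [G], hence do not contain the fresh [x]. *)
    assert (Eargs : map (bind f) args = map (bind (update f x (bind f a))) args).
    { apply map_ext_in; intros b Hb; symmetry.
      apply bind_update_scoped with G; auto.
      rewrite Forall_forall in Hs'; apply Hs', in_or_app; auto. }
    change (collapses (apps (App (bind f (lam x t u)) (bind f a)) (map (bind f) args))) in Hc.
    change (collapses (apps (App (bind f (lam x t u')) (bind f a)) (map (bind f) args))).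
    (* Contracting the head redex on both sides turns the claim into the induction hypothesis for
       the updated [f]. *)
    eapply collapses_expand; [apply apps_par, bind_lam_beta|].
    rewrite Eargs; eapply IH; eauto.
    + eapply Forall_impl; [|exact Hs']; intros b Hb y Hy; right; auto.
    + eauto using scoped_lam_body.
    + now apply realises_update.
    + rewrite <- Eargs; eapply collapses_par; [exact Hc|].
      apply apps_par, bind_lam_beta.
  - destruct args; [|easy].
    now apply Lam_not_collapses in Hc.
Qed.

Lemma sub_prevalid G s u t : sub G s u t -> prevalid G s.
Proof. induction 1; auto. Qed.

Lemma sub_collapses G s u t :
  sub G s u t -> scoped G u -> collapses u -> collapses t.
Proof.
  induction 1; intros Hu Hc; eauto using collapses_expand, eq_red_par.
  apply IHsub; [eauto using sub_red_scoped|].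
  rewrite <- (bind_Var v').
  (* Nothing is substituted or applied yet: [Var] keeps every variable free, and the whole stack is
     [rest]. *)
  apply (sub_red_collapses _ _ _ _ H Var [] s); simpl; auto.
  - eauto using prevalid_stack, sub_prevalid.
  - intros x b _; eauto.
  - now rewrite bind_Var.
Qed.

(* Well-formedness and progress *)
Scheme wf_mut := Minimality for wf Sort Prop
  with sub_wf_mut := Minimality for sub_wf Sort Prop
  with sub_wf_star_mut := Minimality for sub_wf_star Sort Prop.

(** Supplies the scoping hypothesis of [sub_collapses]. For both subtyping judgments the induction
    tracks the left-hand term, which is what an application needs of its operator and operand. *)
Lemma wf_scoped G s t : wf G s t -> scoped G t.
Proof.
  apply (wf_mut (fun G _ t => scoped G t) (fun G _ t _ => scoped G t)
           (fun G _ t _ => scoped G t)); clear; auto.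
  - intros G s x t _ (G1 & G2 & -> & _) _ _ y Hy; simpl in Hy; subst.
    unfold dom; rewrite map_app; apply in_or_app; simpl; auto.
  - easy.
  - intros; eapply scoped_lam; eauto.
  - intros; eapply scoped_lam; eauto.
  - intros G s u v x t _ Hu _ Hv y [Hy|Hy]; auto.
Qed.

Lemma sub_wf_star_collapses G s u t :
  sub_wf_star G s u t -> collapses u -> collapses t.
Proof.
  induction 1 as [G s u t H|]; auto.
  inversion H; subst; eauto using sub_collapses, wf_scoped.
Qed.

Lemma Top_not_sub_wf_star_lam G s x t u : ~ sub_wf_star G s Top (lam x t u).
Proof.
  intros H; apply sub_wf_star_collapses in H; [|constructor].
  now apply Lam_not_collapses in H.
Qed.

Theorem theorem4p1 (t : term) :
  forall (G : ctx) (s : stack), wf G s t ->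
    normal_form t \/ exists t' : term, step t t'.
Proof.
  set (progress t := normal_form t \/ exists t', step t t').
  intros G s; revert G s t.
  apply (wf_mut (fun _ _ t => progress t) (fun _ _ t _ => progress t)
           (fun _ _ t _ => progress t)); unfold progress; clear; auto.
  - intros G s x t _ _ _ _; left; apply (nf_spine x []); easy.
  - left; constructor.
  - intros G x t u _ [Hu|[u' Hu]] _ [Ht|[t' Ht]]; eauto using normal_form, step.
  - intros G s x d t u _ [Hu|[u' Hu]] _ [Ht|[t' Ht]]; eauto using normal_form, step.
  - intros G s u v x t Hsub [Hu|[u' Hu]] _ [Hv|[v' Hv]]; eauto using step.
    (* Operator and operand are normal: [Top] as operator contradicts [Hsub], an abstraction gives a
       beta-step, and a variable spine absorbs [v] as its last operand. *)
    destruct Hu as [|y a b Ha Hb|y ts Hts].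
    + now apply Top_not_sub_wf_star_lam in Hsub.
    + eauto using step.
    + left; change (App (fold_left App ts (Var y)) v)
        with (fold_left App [v] (fold_left App ts (Var y))).
      rewrite <- fold_left_app; apply nf_spine.
      intros w Hw; apply in_app_or in Hw as [Hw|[->|[]]]; auto.
Qed.
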